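(* Let $n\geq 2$ and let $r$ be such that $1\leq r<\frac{n}{2}$ and $\gcd(r,n)=1$, and suppose that $\frac rn$ has extended binary sequence $\sigma_1\cdots\sigma_\ell 1=1\sigma_2\cdots\sigma_\ell 1$, with $\ell=\operatorname{depth}\left(\frac rn\right)-1$. Let $(n_1^{k_1},n_2^{k_2})$ be a partition of $n$ in the $m$-th generation of the orbit of partitions generated by $\frac rn$, that is, suppose there is $1\leq m\leq \ell$ such that \[ \begin{pmatrix} r\\ n\end{pmatrix}=\prod_{j=1}^{m}\Phi_{\sigma_j}\begin{pmatrix} n_2\\ n_1\end{pmatrix}=\begin{pmatrix} t & s\\ k_2 & k_1\end{pmatrix}\begin{pmatrix} n_2\\ n_1\end{pmatrix}. \] Then the conjugate partition $(\tilde n_1^{\tilde k_1},\tilde n_2^{\tilde k_2})$, where $\tilde n_1=k_1+k_2$, $\tilde n_2=k_1$, $\tilde k_1=n_2$, $\tilde k_2=n_1-n_2$, is in the $(\ell+1-m)$-th generation of the orbit of partitions generated by $\frac{\tilde r}{n}$, where $\frac{\tilde r}{n}$ is the fraction with extended binary sequence $\tilde\sigma_1\cdots\tilde\sigma_\ell 1:=1\sigma_\ell\cdots\sigma_2 1$ (the reversal of $\sigma_1\cdots\sigma_\ell 1$). In other words, \[ \begin{pmatrix} \tilde r\\ n\end{pmatrix}=\prod_{j=1}^{\ell+1-m}\Phi_{\tilde\sigma_j}\begin{pmatrix} \tilde n_2\\ \tilde n_1\end{pmatrix}=\begin{pmatrix} \tilde t & \tilde s\\ \tilde k_2 & \tilde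 k_1\end{pmatrix}\begin{pmatrix} \tilde n_2\\ \tilde n_1\end{pmatrix}. \] Moreover, the continued fraction expansion of $\frac{\tilde r}{n}$ has the same digits as that of $\frac rn$, but in reversed order: $\frac rn=[a_1,\ldots,a_k]$ iff $\frac{\tilde r}{n}=[a_k,\ldots,a_1]$.
   Context: The Farey map $F$ on $[0,1]$ is $F(x)=\frac{1-x}{x}$ on $[\frac12,1]$ and $F(x)=\frac{x}{1-x}$ on $[0,\frac12]$, with inverse branches given (acting on column vectors $(p,q)^\top$ representing $p/q$) by the matrices $\Phi_0=\begin{pmatrix}0&1\\1&1\end{pmatrix}$ and $\Phi_1=\begin{pmatrix}1&0\\1&1\end{pmatrix}$. The Farey tree has root $\frac12$, and the children of $\frac pq$ are $\frac{p}{p+q}$ and $\frac{q}{p+q}$; it contains every rational in $(0,1)$ exactly once in lowest terms. The level $\mathcal L_k$ is $F^{-k+1}(\frac12)$, and $\operatorname{depth}(\frac pq)=k$ iff $\frac pq\in\mathcal L_k$. The binary sequence $\sigma(x)=\sigma_1\sigma_2\cdots$ is defined by $F^{j-1}(x)\in(\frac12,1)$ if $\sigma_j=0$ and $F^{j-1}(x)\in(0,\frac12)$ if $\sigma_j=1$, stopping when the image is $\frac12$; for rational $\frac rn$ it has length $\ell=\operatorname{depth}(\frac rn)-1$, and $(r,n)^\top=\prod_{j=1}^{\ell}\Phi_{\sigma_j}(1,2)^\top=\prod_{j=1}^{\ell+1}\Phi_{\sigma_j}(1,1)^\top$ with $\sigma_{\ell+1}\in\{0,1\}$. Choosing $\sigma_{\ell+1}=1$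 gives the extended binary sequence $\sigma_1\cdots\sigma_\ell 1$. For each $m$, writing $(r,n)^\top=\prod_{j=1}^m\Phi_{\sigma_j}\cdot\prod_{j=m+1}^{\ell+1}\Phi_{\sigma_j}(1,1)^\top$ with $\prod_{j=1}^m\Phi_{\sigma_j}=\begin{pmatrix}h_2&h_1\\k_2&k_1\end{pmatrix}$ and $\prod_{j=m+1}^{\ell+1}\Phi_{\sigma_j}(1,1)^\top=(n_2,n_1)^\top$ gives a partition $n=k_1n_1+k_2n_2$, written $(n_1^{k_1},n_2^{k_2})$ (parts $n_1\geq n_2$ with multiplicities $k_1,k_2$), of generation $m$; for $m=1,\ldots,\ell$ these form the orbit of partitions generated by $\frac rn$. The conjugate partition is obtained by flipping the Young shape (rows into columns), and $(n_1^{k_1},n_2^{k_2})$ is conjugate to $((k_1+k_2)^{n_2},k_1^{n_1-n_2})$. *)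

(* Defs.v *)
From mathcomp Require Import all_boot all_order all_algebra.

Set Implicit Arguments.
Unset Strict Implicit.
Unset Printing Implicit Defensive.

Import Order.TTheory GRing.Theory Num.Theory.
Local Open Scope ring_scope.

(* Only meaningful on [0, 1]; the two branches agree at 1/2. *)
Definition farey (R : realFieldType) (x : R) : R :=
  if x <= 2^-1 then x / (1 - x) else (1 - x) / x.

Definition farey_level (k : nat) : pred rat :=
  [pred x | [&& (0 < k)%N, 0 <= x <= 1 & iter k.-1 (@farey rat) x == 2^-1]].

(* The levels are pairwise disjoint because the orbit of 1/2 under the Farey
   map is 1/2, 1, 0, 0, ..., so a rational has at most one depth. *)
Definition has_depth (x : rat) (k : nat) : Prop := x \in farey_level k.

(* Binary digits are booleans: [true] is the digit 1 (branch (0, 1/2)) and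
   [false] the digit 0 (branch (1/2, 1)). The digit sigma_(j+1) is the entry
   of index j. *)
Definition binary_seq (x : rat) (s : seq bool) : Prop :=
  (forall j, (j < size s)%N ->
     if nth false s j then 0 < iter j (@farey rat) x < 2^-1
     else 2^-1 < iter j (@farey rat) x < 1) /\
  iter (size s) (@farey rat) x = 2^-1.

Definition ext_binary_seq (x : rat) (s : seq bool) : Prop :=
  exists2 s', binary_seq x s' & s = rcons s' true.

Definition mx2 (a b c d : nat) : 'M[nat]_2 :=
  \matrix_(i, j) (if i == 0 then (if j == 0 then a else b)
                  else (if j == 0 then c else d)).

Definition cv2 (p q : nat) : 'cV[nat]_2 :=
  \col_i (if i == 0 then p else q).

Definition Phi (b : bool) : 'M[nat]_2 :=
  if b then mx2 1 0 1 1 else mx2 0 1 1 1.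

(* Ordered product of the matrices of the first m digits of s. *)
Definition Phi_prod (s : seq bool) (m : nat) : 'M[nat]_2 :=
  \prod_(b <- take m s) Phi b.

(* The partition (n1^k1, n2^k2) belongs to the m-th generation of the orbit
   generated by r / n. The extended sequence s has length l + 1, so the bound
   on m is 1 <= m <= l. *)
Definition in_generation (r n m n1 k1 n2 k2 : nat) : Prop :=
  exists s : seq bool,
    [/\ ext_binary_seq (r%:R / n%:R) s, (1 <= m < size s)%N &
        exists t u : nat,
          Phi_prod s m = mx2 t u k2 k1 /\
          cv2 r n = mx2 t u k2 k1 *m cv2 n2 n1].

Definition two_size_part (n1 k1 n2 k2 : nat) : seq nat :=
  nseq k1 n1 ++ nseq k2 n2.

(* The i-th part (i >= 0) is the length of the i-th column of the Young shape
   whose rows are the parts of lam. *)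
Definition conj_part (lam : seq nat) : seq nat :=
  [seq count (fun p => i < p)%N lam | i <- iota 0 (\max_(p <- lam) p)].

(* [a_1, ..., a_k] = 1 / (a_1 + 1 / (a_2 + ... + 1 / a_k)). *)
Fixpoint cf_val (a : seq nat) : rat :=
  if a is a1 :: a' then (a1%:R + cf_val a')^-1 else 0.

(* Positive digits and last digit at least 2: the usual normalisation which
   makes the finite expansion of a rational in (0, 1) unique. The reversal
   property fails for the other expansion: 2/5 = [2, 1, 1], but
   [1, 1, 2] = 3/5. *)
Definition cf_expansion (x : rat) (a : seq nat) : Prop :=
  [/\ all (leq 1) a, (2 <= last 0 a)%N & x = cf_val a].

(* Main.v *)
(* Write Phi(w) for the product of the matrices of the digits of a word w.  With
   J = (1 -1; -1 0) one has J Phi_b = Phi_b^T J for both digits b, hence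
   J Phi(rev w) = Phi(w)^T J: reversing a word transposes its product up to
   conjugation by J.  Splitting the extended sequence of r/n as u v with |u| = m,
   the bottom row of Phi(u) is (k2, k1) and Phi(v) (1,1)^T = (n2, n1)^T; the
   relation for v says that the bottom row of Phi(rev v) is (n1 - n2, n2), and
   the one for u that Phi(rev u) (1,1)^T = (k1, k1 + k2)^T, which are the data of
   the conjugate partition.  For continued fractions, [a_1, ..., a_k] has
   extended binary sequence 1^(a_1 - 1) 0 1^(a_2 - 1) 0 ... 0 1^(a_k - 1), a
   pattern that is visibly compatible with reversal. *)

Require Import Defs.
From mathcomp Require Import all_boot all_order all_algebra.
From mathcomp Require Import zify ring lra.

Set Implicit Arguments.
Unset Strict Implicit.
Unset Printing Implicit Defensive.

Import Order.TTheory GRing.Theory Num.Theory.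
Local Open Scope ring_scope.

(** * Products of digit matrices over the natural numbers *)

Definition word_prod (w : seq bool) : 'M[nat]_2 := \prod_(b <- w) Phi b.

Lemma mx2M a b c d a' b' c' d' :
  mx2 a b c d * mx2 a' b' c' d' =
  mx2 (a * a' + b * c')%N (a * b' + b * d')%N
      (c * a' + d * c')%N (c * b' + d * d')%N.
Proof.
apply/matrixP => i j; rewrite -mulmxE !mxE big_ord_recl big_ord1 !mxE /=.
by case: (i == 0); case: (j == 0).
Qed.

Lemma mx2_cv2 a b c d p q :
  mx2 a b c d *m cv2 p q = cv2 (a * p + b * q)%N (c * p + d * q)%N.
Proof.
apply/matrixP => i j; rewrite !mxE big_ord_recl big_ord1 !mxE /=.
by case: (i == 0).
Qed.

Lemma mx2_inj a b c d a' b' c' d' :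
  mx2 a b c d = mx2 a' b' c' d' -> [/\ a = a', b = b', c = c' & d = d'].
Proof.
move=> /matrixP E.
by move: (E 0 0) (E 0 1) (E 1 0) (E 1 1); rewrite !mxE.
Qed.

Lemma cv2_inj p q p' q' : cv2 p q = cv2 p' q' -> p = p' /\ q = q'.
Proof. by move=> /matrixP E; move: (E 0 0) (E 1 0); rewrite !mxE. Qed.

Lemma mx2_ex (M : 'M[nat]_2) : exists a b c d, M = mx2 a b c d.
Proof.
exists (M 0 0), (M 0 1), (M 1 0), (M 1 1).
apply/matrixP => i j; rewrite !mxE.
by case: (unliftP 0 i) => [i'|] ->; case: (unliftP 0 j) => [j'|] -> //=;
  rewrite ?[i']ord1 ?[j']ord1; congr (M _ _); apply/val_inj.
Qed.

Lemma cv2_ex (v : 'cV[nat]_2) : exists p q, v = cv2 p q.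
Proof.
exists (v 0 0), (v 1 0).
apply/matrixP => i j; rewrite !mxE [j]ord1.
by case: (unliftP 0 i) => [i'|] -> //=;
  rewrite ?[i']ord1; congr (v _ _); apply/val_inj.
Qed.

Lemma word_prod_cons b w : word_prod (b :: w) = Phi b * word_prod w.
Proof. by rewrite /word_prod big_cons. Qed.

Lemma word_prod_cat u v : word_prod (u ++ v) = word_prod u * word_prod v.
Proof. by rewrite /word_prod big_cat. Qed.

Lemma word_prod_nil : word_prod [::] = mx2 1 0 0 1.
Proof.
rewrite /word_prod big_nil; apply/matrixP => i j; rewrite !mxE.
by case: (unliftP 0 i) => [i'|] ->; case: (unliftP 0 j) => [j'|] -> //=;
  rewrite ?[i']ord1 ?[j']ord1.
Qed.

Lemma Phi_cv2 b p q : Phi b *m cv2 p q = cv2 (if b then p else q) (p + q)%N.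
Proof. by case: b; rewrite /Phi mx2_cv2; congr cv2; lia. Qed.

(** With no inverse matrices over [nat], the product is cancelled digit by digit: [Phi b] keeps one
    of [p], [q] and their sum, which determine both. *)
Lemma word_prod_cv2_inj w : injective (mulmx (word_prod w) : 'cV_2 -> 'cV_2).
Proof.
elim: w => [|b w IH] u v; first by rewrite /word_prod big_nil -!idmxE !mul1mx.
rewrite word_prod_cons -!mulmxE -!mulmxA => E; apply: IH; move: E.
case: (cv2_ex (word_prod w *m u)) => p [q ->].
case: (cv2_ex (word_prod w *m v)) => p' [q' ->].
by rewrite !Phi_cv2 => /cv2_inj[]; case: b => ? ?; congr cv2; lia.
Qed.

(* The identity J Phi(rev w) = Phi(w)^T J, written without subtraction. *)
Lemma word_prod_rev w a b c d a' b' c' d' :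
  word_prod w = mx2 a b c d -> word_prod (rev w) = mx2 a' b' c' d' ->
  [/\ b' = b, (a' + b = d)%N, d' = (a + b)%N & (c' + d' = c + d)%N].
Proof.
elim: w a b c d a' b' c' d' => [|x w IH] a b c d a' b' c' d'.
  by rewrite word_prod_nil => /mx2_inj[<- <- <- <-] /mx2_inj[<- <- <- <-].
case: (mx2_ex (word_prod w)) => e [f [g [h E]]].
case: (mx2_ex (word_prod (rev w))) => e' [f' [g' [h' E']]].
have [H1 H2 H3 H4] := IH _ _ _ _ _ _ _ _ E E'.
rewrite rev_cons -cats1 word_prod_cat !word_prod_cons word_prod_nil E E'.
by case: x; rewrite /Phi !mx2M => /mx2_inj[<- <- <- <-] /mx2_inj[<- <- <- <-];
  split; lia.
Qed.

(** One digit sends [(p, q)] to [(p, p + q)] or [(q, p + q)]: the gcd is kept, and the sum exceeds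
    either positive term, hence strictness after at least one digit. *)
Lemma word_prod_cv2_bounds w p q p' q' :
  (0 < p <= q)%N -> coprime p q -> word_prod w *m cv2 p q = cv2 p' q' ->
  [/\ (0 < p' <= q')%N, coprime p' q' & w != [::] -> (p' < q')%N].
Proof.
move=> pq cpq; elim: w p' q' => [|b w IH] p' q'.
  by rewrite word_prod_nil mx2_cv2 => /cv2_inj[<- <-];
    rewrite !mul1n !mul0n addn0 add0n.
rewrite word_prod_cons -mulmxE -mulmxA.
case: (cv2_ex (word_prod w *m cv2 p q)) => e [f E].
have [He Hc _] := IH _ _ E.
rewrite E Phi_cv2 => /cv2_inj[<- <-]; split.
- by case: b; lia.
- by case: b; rewrite /coprime ?gcdnDl // gcdnDr gcdnC.
- by case: b; lia.
Qed.

(** Provides [k1 > 0], so that [n1] really occurs among the parts. *)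
Lemma word_prod_botright_gt0 w a b c d :
  word_prod w = mx2 a b c d -> (0 < d)%N.
Proof.
elim: w a b c d => [|x w IH] a b c d.
  by rewrite word_prod_nil => /mx2_inj[_ _ _ <-].
case: (mx2_ex (word_prod w)) => e [f [g [h E]]].
have := IH _ _ _ _ E; rewrite word_prod_cons E.
by case: x; rewrite /Phi !mx2M => ? /mx2_inj[_ _ _ <-]; lia.
Qed.

(** * Inverse branches of the Farey map and binary sequences *)

Definition farey_inv (b : bool) (y : rat) : rat :=
  if b then y / (1 + y) else (1 + y)^-1.

(** The starting point [y] is 1/2 for binary sequences and 1 for extended ones. *)
Fixpoint word_val (y : rat) (w : seq bool) : rat :=
  if w is b :: w' then farey_inv b (word_val y w') else y.

Lemma word_val_cat y u v : word_val y (u ++ v) = word_val (word_val y v) u.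
Proof. by elim: u => //= b u ->. Qed.

Lemma word_val_bounds y w : 0 < y < 1 -> 0 < word_val y w < 1.
Proof.
move=> y01; elim: w => //= b w /andP[x0 x1].
have h : 0 < 1 + word_val y w by lra.
case: b; rewrite /farey_inv.
  by rewrite divr_gt0 //= ltr_pdivrMr //; lra.
by rewrite invr_gt0 h /= invf_lt1 //; lra.
Qed.

Definition branch (b : bool) (x : rat) : bool :=
  if b then 0 < x < 2^-1 else 2^-1 < x < 1.

Lemma binary_seq_cons x b w :
  binary_seq x (b :: w) <-> branch b x /\ binary_seq (farey x) w.
Proof.
split=> [[H1 H2]|[H0 [H1 H2]]].
  split; first by have := H1 0%N isT; rewrite /branch /=; case: (b).
  split=> [j jw|]; last by rewrite -iterSr.
  by have := H1 j.+1 jw; rewrite /= -iterSr.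
split=> [[|j] jw|]; last by rewrite /= -iterS iterSr.
  by move: H0; rewrite /branch /=; case: (b).
by rewrite /= -iterS iterSr; apply: H1.
Qed.

(** Each branch of the Farey map is a bijection from its open half interval onto (0, 1). *)
Lemma farey_invP b x y :
  0 < y < 1 -> (branch b x /\ farey x = y) <-> x = farey_inv b y.
Proof.
move=> /andP[y0 y1]; have h : 0 < 1 + y by lra.
have n1 : 1 + y != 0 by rewrite gt_eqF.
rewrite /branch /farey /farey_inv; split=> [[]|->].
  case: b => /andP[xl xr].
    rewrite ltW // => <-.
    have ? : 1 - x != 0 by apply/eqP; lra.
    by field; rewrite subrK oner_neq0 andbT.
  rewrite leNgt xl /= => <-.
  have ? : x != 0 by apply/eqP; lra.
  by field; rewrite [x + _]addrC subrK oner_neq0 andbT.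
case: b.
  have E : y / (1 + y) < 2^-1 by rewrite ltr_pdivrMr //; lra.
  rewrite E (ltW E) divr_gt0 //; split=> //.
  by field; rewrite n1 addrK oner_neq0.
have E : 2^-1 < (1 + y)^-1 by rewrite ltf_pV2 ?posrE //; lra.
rewrite E leNgt E /= invf_lt1 ?posrE //; split; first by lra.
by field.
Qed.

Lemma binary_seqP x w : binary_seq x w <-> x = word_val 2^-1 w.
Proof.
elim: w x => [|b w IH] x; first by split=> [[]|->].
have /farey_invP H : 0 < word_val 2^-1 w < 1 by apply: word_val_bounds.
rewrite binary_seq_cons; split=> [[H1 /IH H2]|H1].
  exact/H.
by have /H[? /IH] := H1.
Qed.

(** The two branch intervals are disjoint, which fixes each digit, and 1/2 lies in neither, which
    fixes the length. *)
Lemma binary_seq_uniq x w w' : binary_seq x w -> binary_seq x w' -> w = w'.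
Proof.
elim: w x w' => [|b w IH] x [|b' w'] //.
- by move=> [_ /= E] /binary_seq_cons[+ _]; rewrite E /branch ltxx andbF;
    case: b'.
- by move=> /binary_seq_cons[H _] [_ /= E]; move: H; rewrite E /branch ltxx;
    case: b; rewrite ?andbF.
move=> /binary_seq_cons[B1 S1] /binary_seq_cons[B2 S2].
rewrite (IH _ _ S1 S2); congr cons.
by move: B1 B2; rewrite /branch; case: b; case: b' => //;
  move=> /andP[? ?] /andP[? ?]; lra.
Qed.

(** Branch 1 sends 1 to 1/2. *)
Lemma word_val_rcons w : word_val 1 (rcons w true) = word_val 2^-1 w.
Proof. by rewrite -cats1 word_val_cat /= mul1r. Qed.

Lemma ext_binary_seqP x w :
  ext_binary_seq x (rcons w true) <-> x = word_val 1 (rcons w true).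
Proof.
rewrite word_val_rcons -binary_seqP; split=> [[w' H /rcons_inj[->]] //|H].
by exists w.
Qed.

Lemma word_val_inj w w' :
  word_val 1 (rcons w true) = word_val 1 (rcons w' true) -> w = w'.
Proof.
rewrite !word_val_rcons => E.
by apply: (@binary_seq_uniq (word_val 2^-1 w)); apply/binary_seqP.
Qed.

Lemma word_prod_val w p q :
  word_prod w *m cv2 1 1 = cv2 p q -> p%:R / q%:R = word_val 1 w.
Proof.
elim: w p q => [|b w IH] p q.
  by rewrite word_prod_nil mx2_cv2 => /cv2_inj[<- <-]; rewrite divr1.
rewrite word_prod_cons -mulmxE -mulmxA.
case: (cv2_ex (word_prod w *m cv2 1 1)) => e [f E].
have [/andP[e0 ef] _ _] := @word_prod_cv2_bounds w 1 1 e f isT isT E.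
have f0 : (0 : rat) < f%:R by rewrite ltr0n; lia.
have {}e0 : (0 : rat) < e%:R by rewrite ltr0n.
rewrite E Phi_cv2 /= => /cv2_inj[<- <-]; rewrite -(IH _ _ E) natrD.
have ? : f%:R + e%:R != 0 :> rat by rewrite gt_eqF // addr_gt0.
have ? : e%:R + f%:R != 0 :> rat by rewrite gt_eqF // addr_gt0.
by case: b; rewrite /farey_inv; field; rewrite ?gt_eqF // ?addr_gt0.
Qed.

Lemma coprime_frac_inj p q p' q' :
  (0 < q)%N -> (0 < q')%N -> coprime p q -> coprime p' q' ->
  p%:R / q%:R = p'%:R / q'%:R :> rat -> p = p' /\ q = q'.
Proof.
move=> q0 q0' c c' /eqP.
rewrite eqr_div ?pnatr_eq0 -?lt0n // -!natrM eqr_nat => /eqP E.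
have qq : q = q'.
  apply/eqP; rewrite eqn_dvd; apply/andP; split.
    by rewrite -(@Gauss_dvdr q p) 1?coprime_sym // E dvdn_mull.
  by rewrite -(@Gauss_dvdr q' p') 1?coprime_sym // -E dvdn_mull.
by split=> //; move: E; rewrite qq => /eqP; rewrite eqn_pmul2r // => /eqP.
Qed.

(** * Conjugates of partitions with two part sizes *)

Lemma count_two_size_part i n1 k1 n2 k2 :
  count (fun p => i < p)%N (two_size_part n1 k1 n2 k2) =
  ((i < n1) * k1 + (i < n2) * k2)%N.
Proof. by rewrite /two_size_part count_cat !count_nseq. Qed.

(** The first [n2] columns meet all [k1 + k2] rows, the next [n1 - n2] only the [k1] long ones;
    [0 < k1] makes [n1] the number of columns. *)
Lemma conj_two_size_part n1 k1 n2 k2 : (0 < k1)%N -> (n2 <= n1)%N ->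
  conj_part (two_size_part n1 k1 n2 k2) =
  two_size_part (k1 + k2) n2 k1 (n1 - n2).
Proof.
move=> k0 n12; rewrite /conj_part.
have -> : (\max_(p <- two_size_part n1 k1 n2 k2) p = n1)%N.
  apply/eqP; rewrite eqn_leq; apply/andP; split.
    apply/bigmax_leqP_seq => p; rewrite mem_cat => /orP[] /nseqP[-> _] //.
  by apply: (@leq_bigmax_seq _ _ predT id) => //;
    rewrite mem_cat mem_nseq k0 eqxx.
have map_cst (F : nat -> nat) c i0 k :
    (forall i, i0 <= i < i0 + k -> F i = c)%N -> map F (iota i0 k) = nseq k c.
  move=> Fc; rewrite -[in RHS](size_iota i0 k) -(size_map F).
  by apply/all_pred1P/allP => x /mapP[i]; rewrite mem_iota => /Fc Fi -> /=;
    rewrite Fi.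
rewrite -{2}(subnKC n12) iotaD map_cat /two_size_part add0n.
by congr (_ ++ _); apply: map_cst => i ?; rewrite count_two_size_part; lia.
Qed.

(** * Continued fractions as words *)

Fixpoint cf_word (a : seq nat) : seq bool :=
  match a with
  | [::] => [::]
  | [:: a1] => nseq a1.-1 true
  | a1 :: a' => nseq a1.-1 true ++ false :: cf_word a'
  end.

(** In the coordinate 1/y, branch 1 is translation by 1. *)
Lemma word_val_nseq_true z k :
  0 < z -> word_val z^-1 (nseq k true) = (k%:R + z)^-1.
Proof.
move=> z0; elim: k => [|k IH] /=; first by rewrite add0r.
rewrite IH.
have kz : 0 < k%:R + z by rewrite ltr_wpDl.
rewrite -[k.+1]add1n natrD -addrA; field.
by apply/andP; split; apply/lt0r_neq0; lra.
Qed.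

Lemma cf_val_ge0 a : 0 <= cf_val a.
Proof. by elim: a => //= x a IH; rewrite invr_ge0 addr_ge0. Qed.

(** Digit 0 sends [v] to 1/(1 + v), and x - 1 translations then give 1/(x + v). The last block has
    no 0 but starts from 1, which supplies the same extra unit. *)
Lemma word_val_cf_word a :
  a != [::] -> all (leq 1) a -> word_val 1 (cf_word a) = cf_val a.
Proof.
elim: a => // x [|y a] IH _ /= /andP[x0 Ha].
  rewrite -[1 in LHS]invr1 word_val_nseq_true // addr0.
  by rewrite natr1 prednK.
have := IH isT Ha; rewrite -[cf_val (y :: a)]/(y%:R + cf_val a)^-1.
move: (cf_val_ge0 (y :: a)) => /=; move: (_^-1) => v v0 E.
rewrite word_val_cat [word_val 1 _]/= E.
rewrite word_val_nseq_true; last by rewrite ltr_pwDl.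
by rewrite addrA natr1 prednK.
Qed.

Lemma cf_word_rcons a x :
  a != [::] -> cf_word (rcons a x) = cf_word a ++ false :: nseq x.-1 true.
Proof.
elim: a => // y [|z a] IH _ //.
rewrite -[cf_word _]/(nseq y.-1 true ++ false :: cf_word (rcons (z :: a) x)).
by rewrite IH // -cat_cons catA.
Qed.

Lemma cf_word_rev a : cf_word (rev a) = rev (cf_word a).
Proof.
elim: a => // x [|y a] IH; first by rewrite /= rev_nseq.
rewrite rev_cons cf_word_rcons; last by rewrite -size_eq0 size_rev.
by rewrite IH /= rev_cat rev_cons rev_nseq cat_rcons.
Qed.

(** Used on reversed lists, where it matches a last digit at least 2 with a word ending in 1. The
    default [false] covers the empty word of [[::]] and [[:: 1]]. *)
Lemma head_cf_word a : head false (cf_word a) = (2 <= head 0 a)%N.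
Proof. by case: a => // -[|[|x]] [|y a]. Qed.

(** By uniqueness of the binary sequence, expanding the value amounts to spelling the word; the
    normalisation of the last digit corresponds to the final 1. *)
Lemma cf_expansion_word w a :
  cf_expansion (word_val 1 (rcons w true)) a <->
  all (leq 1) a /\ cf_word a = rcons w true.
Proof.
split=> [[H1 H2 E]|[H1 E]].
  have a0 : a != [::] by case: (a) H2.
  split=> //.
  (* [word_val_inj] compares words ending in 1, so the final letter of [cf_word a] is found
     first. *)
  have : head false (cf_word (rev a)) = true.
    by rewrite head_cf_word -nth0 nth_rev -?subn1 ?lt0n ?size_eq0 // subn1
      nth_last.
  case Er: (cf_word (rev a)) => [|b u] //= Eb.
  have Ea : cf_word a = rcons (rev u) true.
    by rewrite -[a]revK cf_word_rev Er rev_cons Eb.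
  by rewrite Ea; congr rcons; apply: word_val_inj; rewrite -Ea word_val_cf_word.
have a0 : a != [::] by case: (a) E => //; case: (w).
split; rewrite -?E ?word_val_cf_word //.
have := head_cf_word (rev a); rewrite cf_word_rev E rev_rcons /=.
by rewrite -nth0 nth_rev -?subn1 ?lt0n ?size_eq0 // subn1 nth_last => <-.
Qed.

(** Since the word starts and ends with 1, both the list and its reversal are normalised. *)
Lemma cf_expansion_rev u a :
  cf_expansion (word_val 1 (rcons (true :: u) true)) a <->
  cf_expansion (word_val 1 (rcons (true :: rev u) true)) (rev a).
Proof.
rewrite !cf_expansion_word all_rev cf_word_rev.
have -> : rcons (true :: rev u) true = rev (rcons (true :: u) true).
  by rewrite rev_rcons rev_cons.
by split=> -[-> E]; split=> //; [rewrite E | apply: (can_inj revK)].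
Qed.

Theorem theorem4p7 (n r l : nat) (sigma : l.-tuple bool)
    (hn : (2 <= n)%N) (hr1 : (1 <= r)%N) (hr2 : (r%:R < n%:R / 2 :> rat))
    (hrn : coprime r n)
    (hl : has_depth (r%:R / n%:R) l.+1)
    (hsigma : ext_binary_seq (r%:R / n%:R) (rcons sigma true))
    (hsigma1 : head false sigma = true) :
  exists rt : nat,
    [/\ (1 <= rt < n)%N /\ coprime rt n,
        has_depth (rt%:R / n%:R) l.+1,
        forall x : rat,
          ext_binary_seq x (rev (rcons sigma true)) <-> x = rt%:R / n%:R,
        forall (m n1 k1 n2 k2 t s : nat),
          (1 <= m <= l)%N ->
          cv2 r n = Phi_prod (rcons sigma true) m *m cv2 n2 n1 ->
          Phi_prod (rcons sigma true) m = mx2 t s k2 k1 ->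
          let nt1 := (k1 + k2)%N in
          let nt2 := k1 in
          let kt1 := n2 in
          let kt2 := (n1 - n2)%N in
          [/\ conj_part (two_size_part n1 k1 n2 k2)
                = two_size_part nt1 kt1 nt2 kt2,
              in_generation rt n (l + 1 - m) nt1 kt1 nt2 kt2 &
              exists tt st : nat,
                cv2 rt n
                  = Phi_prod (rev (rcons sigma true)) (l + 1 - m) *m cv2 nt2 nt1
                /\ Phi_prod (rev (rcons sigma true)) (l + 1 - m)
                  = mx2 tt st kt2 kt1] &
        forall a : seq nat,
          cf_expansion (r%:R / n%:R) a <-> cf_expansion (rt%:R / n%:R) (rev a)].
Proof.
(* The default [false] of [head] excludes the empty sequence. *)
case: sigma hsigma1 hsigma => -[//|b u] Hsize /= E1 hs; subst b.
have [p [q E]] := cv2_ex (word_prod (rcons (true :: u) true) *m cv2 1 1).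
have [/andP[p0 pq] cpq _] := @word_prod_cv2_bounds _ 1 1 _ _ isT isT E.
(* Both fractions are reduced and have the same value, so [(p, q)] is [(r, n)]. *)
have := hs; rewrite -rcons_cons => /ext_binary_seqP; rewrite -(word_prod_val E).
case/coprime_frac_inj => //; [lia | lia | move=> Ep Eq; subst p q].
have Erev : rev (rcons (true :: u) true) = rcons (true :: rev u) true.
  by rewrite rev_rcons rev_cons.
have [rt [n' E']] :=
  cv2_ex (word_prod (rev (rcons (true :: u) true)) *m cv2 1 1).
(* The denominators are the sums of the bottom rows, which reversal preserves. *)
have nn : n' = n.
  case: (mx2_ex (word_prod (rcons (true :: u) true))) => a [b [c [d H]]].
  case: (mx2_ex (word_prod (rev (rcons (true :: u) true)))) =>
    a' [b' [c' [d' H']]].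
  have [_ _ _ H4] := word_prod_rev H H'.
  by move: E E'; rewrite H H' !mx2_cv2 => /cv2_inj[_ <-] /cv2_inj[_ <-]; lia.
subst n'.
have [/andP[rt0 _] crt rtn] := @word_prod_cv2_bounds _ 1 1 _ _ isT isT E'.
have {}rtn : (rt < n)%N by apply: rtn; rewrite Erev.
have Vr := word_prod_val E; have Vrt := word_prod_val E'.
have Hext x : ext_binary_seq x (rev (rcons (true :: u) true)) <->
    x = rt%:R / n%:R by rewrite Vrt Erev; apply: ext_binary_seqP.
exists rt; split=> //.
- by rewrite rt0 rtn.
(* The underlying binary sequence has length [l], and its terminal condition says that the [l]-th
   iterate is 1/2, that is, depth [l + 1]. *)
- have /Hext := erefl (rt%:R / n%:R : rat).
  rewrite Erev => -[w [_ Hw] /rcons_inj[Ew]]; subst w.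
  rewrite /has_depth /farey_level !inE /=; apply/andP; split.
    rewrite divr_ge0 //= ler_pdivrMr ?ltr0n ?mul1r ?ler_nat; lia.
  have <- : size (true :: rev u) = l by rewrite /= size_rev -(eqP Hsize).
  by apply/eqP.
- move=> m n1 k1 n2 k2 t s /andP[m1 ml] Em Et /=.
  set w := rcons (true :: u) true in E E' Em Et Hext *.
  have szw : size w = l.+1 by rewrite /w size_rcons (eqP Hsize).
  have szd : size (drop m w) = (l + 1 - m)%N by rewrite size_drop szw addn1.
  have Ew : w = take m w ++ drop m w by rewrite cat_take_drop.
  have Et' : word_prod (take m w) = mx2 t s k2 k1 by [].
  (* Cancel the common prefix product in the two expressions for [(r, n)]. *)
  have Ev : word_prod (drop m w) *m cv2 1 1 = cv2 n2 n1.
    apply: (@word_prod_cv2_inj (take m w)); rewrite -Em -E [in RHS]Ew.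
    by rewrite word_prod_cat -mulmxE mulmxA.
  have Edr : take (l + 1 - m) (rev w) = rev (drop m w).
    by rewrite [in LHS]Ew rev_cat -szd -size_rev take_size_cat.
  have k0 := word_prod_botright_gt0 Et'.
  have [/andP[n20 n21] _ _] := @word_prod_cv2_bounds _ 1 1 _ _ isT isT Ev.
  case: (mx2_ex (word_prod (drop m w))) => a [b [c [d Hv]]].
  case: (mx2_ex (word_prod (rev (drop m w)))) => a' [b' [c' [d' Hv']]].
  case: (mx2_ex (word_prod (rev (take m w)))) => e [f [g [h Hu']]].
  have [V1 V2 V3 V4] := word_prod_rev Hv Hv'.
  have [U1 U2 U3 U4] := word_prod_rev Et' Hu'.
  move: Ev; rewrite Hv mx2_cv2 => /cv2_inj[Ea Ec].
  (* [V3] gives [d' = n2], and [V4] then gives [c' = n1 - n2], an exact subtraction by [n21]. *)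
  have Bot : Phi_prod (rev w) (l + 1 - m) = mx2 a' b' (n1 - n2) n2.
    by rewrite /Phi_prod Edr -/(word_prod _) Hv'; congr mx2; lia.
  (* The rest of [rev w] is the reversed prefix, applied to (1, 1): [U1] and [U2] give [e + f = k1],
     and [U4] gives [g + h = k1 + k2]. *)
  have Gen : cv2 rt n = Phi_prod (rev w) (l + 1 - m) *m cv2 k1 (k1 + k2).
    rewrite /Phi_prod Edr -/(word_prod _) -E' [in LHS]Ew rev_cat word_prod_cat.
    rewrite -mulmxE -mulmxA Hu' mx2_cv2; congr (_ *m cv2 _ _); lia.
  split; first exact: conj_two_size_part.
    exists (rev w); split; first exact/Hext.
      by rewrite size_rev szw; lia.
    by exists a', b'; split=> //; rewrite -Bot.
  by exists a', b'.
- by move=> a; rewrite Vr Vrt Erev; apply: cf_expansion_rev.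
Qed.
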